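(* Let $\langle \mathcal M,\tau\rangle$ be a free probability space, let $n\ge 2$, and let $x_1,\ldots,x_n$ be random variables in $\mathcal M$ (i.e. elements of $\mathcal M$) that are free with respect to $\tau$. For each $q\ge 1$ let $D_q(x_1,\ldots,x_n)$ be the Hankel determinant of $x_1,\ldots,x_n$, and for each $1\le k\le n$ let $\mathcal E_n(x_k)$ be the $n$-th entropy number of $x_k$. Then $$\lim_{q\to\infty}\frac{\ln D_{q+1}(x_1,\ldots,x_n)}{q\cdot n^{q}}=\frac{n-1}{n}\sum_{k=1}^n \mathcal E_n(x_k).$$
   Context: A free probability space $\langle \mathcal M,\tau\rangle$ is a finite von Neumann algebra $\mathcal M$ (with identity $I$) with a faithful normal tracial state $\tau$. $L^2(\mathcal M,\tau)$ is the Hilbert space completion of $\mathcal M$ for the inner product $\langle a,b\rangle=\tau(b^*a)$, with norm $\|a\|_2=\tau(a^*a)^{1/2}$; elements of $\mathcal M$ are viewed as vectors in it. Freeness: von Neumann subalgebras $\mathcal M_i$ ($i\in\mathcal I$) of $\mathcal M$ are free with respect to $\tau$ if $\tau(y_1\cdots y_m)=0$ for every $m\ge1$ whenever $y_j\in\mathcal M_{i_j}$, $\tau(y_j)=0$ for $1\le j\le m$, and $i_j\ne i_{j+1}$ for $1\le j<m$ (only adjacent indices must differ). Elements $x_1,\ldots,x_n$ are free if the von Neumann subalgebras they generate (one for each $x_k$) are free. Words: $\Sigma_n$ is the free unital semigroup on generators $X_1,\ldots,X_n$ with unit $e$. The length is $|e|=0$ and $|X_{i_1}\cdots X_{i_q}|=q$.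 For $\alpha=X_{i_1}\cdots X_{i_q}$ put $x_\alpha=x_{i_1}\cdots x_{i_q}\in\mathcal M$, and $x_e=I$. Hankel determinant: for $q\ge1$, $D_q(x_1,\ldots,x_n)=\det\big(\tau(x_\alpha^*x_\beta)\big)_{|\alpha|,|\beta|<q}$, the determinant of the matrix with rows and columns indexed by all words $\alpha,\beta\in\Sigma_n$ of length $<q$. Entropy number: for $x\in\mathcal M$ and $j\ge1$, let $P_j(x)=x^j-E_j(x^j)$, where $E_j$ is the orthogonal projection of $L^2(\mathcal M,\tau)$ onto the linear span of $\{I,x,\ldots,x^{j-1}\}$. The $n$-th entropy number of $x$ is $$\mathcal E_n(x)=\sum_{j=1}^\infty\frac{\ln\|P_j(x)\|_2^2}{n^j}.$$ Convention: $\ln 0=-\infty$; the series defining $\mathcal E_n(x)$ and the limit are taken in $[-\infty,\infty)$. *)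

(* Defs.v *)
From HB Require Import structures.
From mathcomp Require Import all_boot all_order all_algebra.
From mathcomp Require Import complex.
From mathcomp Require Import all_classical all_reals all_analysis.

Set Implicit Arguments.
Unset Strict Implicit.
Unset Printing Implicit Defensive.

Import Order.TTheory GRing.Theory Num.Theory.
Import numFieldNormedType.Exports.

Local Open Scope classical_set_scope.
Local Open Scope ring_scope.

Section HilbertSpaceOperators.
Variables (R : realType) (H : completeNormedModType R[i]).
Variable dot : {dot H for @Num.conj R[i]}.

(* [H] is a Hilbert space when [dot] induces its norm; completeness is part of
   the type of [H]. The form [dot] is linear in its first argument and
   conjugate-linear in its second. *)
Definition is_hilbert := forall u : H, dot u u = `|u| ^+ 2.

Definition bounded_operator (a : H -> H) :=
  linear a /\ exists k : R[i], forall u, `|a u| <= k * `|u|.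

Definition is_adjoint (a b : H -> H) := forall u v, dot (a u) v = dot u (b v).

(* Adjoints are unique; the default value is only used when none exists, which
   does not happen for elements of a von Neumann algebra. *)
Definition adj (a : H -> H) : H -> H := xget 0 [set b | is_adjoint a b].

Definition commutant (S : set (H -> H)) : set (H -> H) :=
  [set b | bounded_operator b /\ forall a, S a -> a \o b = b \o a].

(* The bicommutant condition entails that elements of [M] are bounded operators
   and that [M] is a unital subalgebra of B(H). *)
Definition von_neumann_algebra (M : set (H -> H)) :=
  (forall a, M a -> exists2 b, M b & is_adjoint a b) /\
  commutant (commutant M) = M.

Definition finite_algebra (M : set (H -> H)) :=
  forall v, M v -> adj v \o v = idfun -> v \o adj v = idfun.

Definition vn_generated (x : H -> H) : set (H -> H) :=
  [set a | forall N, von_neumann_algebra N -> N x -> N a].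

(* In [R[i]], [0 <= z] means that [z] is real and nonnegative. *)
Definition op_le (a b : H -> H) := forall u, 0 <= dot (b u - a u) u.

Definition is_lub (T : Type) (le : T -> T -> Prop) (D A : set T) (a : T) :=
  [/\ D a, forall b, A b -> le b a &
      forall c, D c -> (forall b, A b -> le b c) -> le a c].

(* Suprema of bounded increasing nets are those of nonempty directed sets. *)
Definition normal_on (M : set (H -> H)) (tau : (H -> H) -> R[i]) :=
  forall (A : set (H -> H)) (a : H -> H),
    A !=set0 -> A `<=` M -> (forall b, A b -> is_adjoint b b) ->
    (forall b c, A b -> A c -> exists d, [/\ A d, op_le b d & op_le c d]) ->
    is_lub op_le M A a ->
    is_lub (fun s t : R[i] => s <= t) setT (tau @` A) (tau a).

(* The values of [tau] outside [M] are irrelevant. *)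
Record free_probability_space (M : set (H -> H)) (tau : (H -> H) -> R[i]) := {
  fps_hilbert : is_hilbert;
  fps_vna : von_neumann_algebra M;
  fps_finite : finite_algebra M;
  fps_linear : forall (c : R[i]) a b, M a -> M b ->
    tau (c *: a + b) = c * tau a + tau b;
  fps_unit : tau idfun = 1;
  fps_positive : forall a, M a -> 0 <= tau (adj a \o a);
  fps_faithful : forall a, M a -> tau (adj a \o a) = 0 -> a = 0;
  fps_tracial : forall a b, M a -> M b -> tau (a \o b) = tau (b \o a);
  fps_normal : normal_on M tau }.

Definition op_prod (I : Type) (s : seq I) (y : I -> H -> H) : H -> H :=
  \big[@comp H H H/idfun]_(i <- s) y i.

Definition free_subalgebras (tau : (H -> H) -> R[i]) (I : Type)
    (N : I -> set (H -> H)) :=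
  forall (m : nat) (i : nat -> I) (y : nat -> H -> H), (0 < m)%N ->
    (forall j, (j < m)%N -> N (i j) (y j) /\ tau (y j) = 0) ->
    (forall j, (j.+1 < m)%N -> i j <> i j.+1) ->
    tau (op_prod (iota 0 m) y) = 0.

Definition free_elements (tau : (H -> H) -> R[i]) (I : Type)
    (x : I -> H -> H) :=
  free_subalgebras tau (fun k => vn_generated (x k)).

(* The words of length < q form the finite type [q.-1.-bseq 'I_n] when
   0 < q. The determinant does not depend on their enumeration, and is real as
   that of a hermitian matrix. *)
Definition hankel_det (tau : (H -> H) -> R[i]) (n : nat)
    (x : 'I_n -> H -> H) (q : nat) : R :=
  complex.Re (\det (\matrix_(i < #|{: q.-1.-bseq 'I_n}|, j < #|{: q.-1.-bseq 'I_n}|)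
    tau (adj (op_prod (enum_val i : q.-1.-bseq 'I_n) x) \o
         op_prod (enum_val j : q.-1.-bseq 'I_n) x))).

Definition l2dot (tau : (H -> H) -> R[i]) (a b : H -> H) : R[i] :=
  tau (adj b \o a).

Definition l2norm (tau : (H -> H) -> R[i]) (a : H -> H) : R :=
  Num.sqrt (complex.Re (l2dot tau a a)).

(* For a finite-dimensional subspace [S] of the algebra and [a] in the algebra,
   the orthogonal projection of [a] onto [S] in the L2-completion is the unique
   [e] in [S] with [a - e] orthogonal to [S]. *)
Definition l2proj (tau : (H -> H) -> R[i]) (S : set (H -> H)) (a : H -> H) :
    H -> H :=
  xget 0 [set e | S e /\ forall s, S s -> l2dot tau (a - e) s = 0].

Definition power_span (x : H -> H) (j : nat) : set (H -> H) :=
  [set a | exists c : 'I_j -> R[i], a = \sum_(i < j) c i *: (iter i x : H -> H)].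

Definition power_residual (tau : (H -> H) -> R[i]) (x : H -> H) (j : nat) :
    H -> H :=
  (iter j x : H -> H) - l2proj tau (power_span x j) (iter j x).

Definition entropy_number (tau : (H -> H) -> R[i]) (n : nat) (x : H -> H) :
    \bar R :=
  (\sum_(1 <= j <oo)
     lne (l2norm tau (power_residual tau x j) ^+ 2)%:E * (n%:R ^- j)%:E)%E.

End HilbertSpaceOperators.

(* Main.v *)
Require Import Defs.
From HB Require Import structures.
From mathcomp Require Import all_boot all_order all_algebra.
From mathcomp Require Import complex.
From mathcomp Require Import all_classical all_reals all_analysis.
From mathcomp Require Import fingroup perm.
From mathcomp Require Import ring lra zify.
Import Order.TTheory GRing.Theory Num.Theory.
Import numFieldNormedType.Exports.
Local Open Scope classical_set_scope.
Local Open Scope ring_scope.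

Set Implicit Arguments.
Unset Strict Implicit.
Unset Printing Implicit Defensive.

(** The Hankel determinant is the Gram determinant of the words of length at
most [q] in [L2(M, tau)]. Cut a word into its runs
[X_k1^j1 ... X_km^jm] with adjacent [k]'s distinct, and replace every power
[x_k^j] by its residual [P_j(x_k)], the part orthogonal to the lower powers.
This changes each word by shorter words only, so the change of basis is
unitriangular ([run_op_word_span], [det_unitriangular]) and the determinant
stays the same. By freeness the new family is orthogonal, and the squared norm
of a product of residuals is the product of the numbers
[h k j = ||P_j(x_k)||^2] over the runs ([run_op_l2dot]). Hence the determinant is
the product of all these numbers over all runs of all words
([hankel_det_run_prod]).

The logarithm [d_q] of this product satisfies, with
[S_q = sum_k sum_(1 <= j <= q) ln (h k j) / n^j],
the exact formula
  [d_q / n^q = S_q + (n - 1) / n * sum_(m < q) S_m],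
which comes from peeling off the first letter of a word ([sum_run_sum]). Divided
by [q], the second term is a Cesaro mean of the partial sums [S_m], whose limit
is the sum of the entropy numbers, and the first term disappears
([cesaro_combination]).

The partial sums converge in [[-oo, +oo[] because [h k j] grows at most
geometrically in [j] ([residual_norm_bound], [cvg_bounded_series]). This is where
the operator norm has to be compared with [tau]: normality, applied to a chain
with two elements, says that [tau] is monotone for the operator order
([tau_le]), so [tau (a^* x^* x a) <= K^2 tau (a^* a)] when [||x|| <= K]. If some
[h k j] vanishes, both sides are [-oo]. *)

(** * Words and their runs *)

Section Words.
Variable T : finType.

(** Listing the words letter by letter, rather than as bounded sequences, turns
every sum over the words of length at most [q] into a recursion on [q]
([sum_wordsS]). *)
Fixpoint words (q : nat) : seq (seq T) :=
  if q is q'.+1 then [::] :: [seq k :: v | k <- enum T, v <- words q'] else [:: [::]].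

Lemma mem_words q w : (w \in words q) = (size w <= q)%N.
Proof.
elim: q w => [|q IH] [|k w] //=.
rewrite inE /= ltnS -IH; apply/allpairsP/idP => [[[l v] /= [_ vq [_ ->]]] //|wq].
by exists (k, w); rewrite mem_enum.
Qed.

Lemma words_uniq q : uniq (words q).
Proof.
elim: q => //= q IH; apply/andP; split; first by apply/allpairsP => -[[]] ? ? [].
by apply: allpairs_uniq => //; [exact: enum_uniq | move=> [? ?] [? ?] _ _ [-> ->]].
Qed.

Lemma big_bseq (V : Type) (idx : V) (op : Monoid.com_law idx) q (F : seq T -> V) :
  \big[op/idx]_(w : q.-bseq T) F w = \big[op/idx]_(w <- words q) F w.
Proof.
rewrite -(big_map val predT F) /index_enum -enumT.
apply: perm_big; apply: uniq_perm => [||w].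
- by rewrite map_inj_uniq ?enum_uniq //; exact: val_inj.
- exact: words_uniq.
rewrite mem_words; apply/mapP/idP => [[v _ ->]|wq]; first exact: size_bseq.
by exists (Bseq wq) => //; rewrite mem_enum.
Qed.

Lemma sum_wordsS (V : nmodType) q (F : seq T -> V) :
  \sum_(w <- words q.+1) F w = F [::] + \sum_k \sum_(v <- words q) F (k :: v).
Proof.
rewrite big_cons; congr (_ + _); rewrite big_allpairs_dep /=.
by rewrite big_enum.
Qed.

(** The normal form of a word in the free product of the monogenic semigroups of
the letters: maximal powers of a single letter, as pairs of the letter and its
exponent. *)
Fixpoint runs (w : seq T) : seq (T * nat) :=
  if w is k :: v then
    if runs v is p :: r then
      if k == p.1 then (k, p.2.+1) :: r else [:: (k, 1%N), p & r]
    else [:: (k, 1%N)]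
  else [::].

Definition first_run (k : T) (w : seq T) : nat :=
  if runs w is p :: _ then if k == p.1 then p.2 else 0%N else 0%N.

Definition of_runs (r : seq (T * nat)) : seq T := flatten [seq nseq p.2 p.1 | p <- r].

Lemma runsK : cancel runs of_runs.
Proof.
elim=> //= k v; rewrite /of_runs; case: (runs v) => [|[l j] r] /=; first by move=> <-.
by case: eqP => [->|_] /= ->.
Qed.

Lemma runs_alternate w : sorted (fun p p' : T * nat => p.1 != p'.1) (runs w).
Proof.
elim: w => //= k v; case: (runs v) => [|[l j] r] //=.
by case: eqP => [->|/eqP kl] //=; [case: r | rewrite kl].
Qed.

Lemma runs_gt0 w : all (fun p => 0 < p.2)%N (runs w).
Proof.
by elim: w => //= k v; case: (runs v) => [|[l j] r] //= /andP[? ?]; case: eqP => //= _; apply/andP.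
Qed.

Lemma runs_nseq k j : runs (nseq j.+1 k) = [:: (k, j.+1)].
Proof. by elim: j => //= j ->; rewrite eqxx. Qed.

Lemma first_run_cons k l w :
  first_run k (l :: w) = if k == l then (first_run k w).+1 else 0%N.
Proof.
rewrite /first_run /=; case: (runs w) => [|[m j] r] /=; first by case: eqP.
case: (eqVneq l m) => [->|/negbTE lm] /=; first by case: eqP.
by case: (eqVneq k l) => [->|_] //; rewrite lm.
Qed.

Section Sums.
Variables (F : comPzRingType) (L : T -> nat -> F).
Hypothesis L0 : forall k, L k 0 = 0.
Local Notation n := (#|T|%:R : F).

Definition run_sum (w : seq T) : F := \sum_(p <- runs w) L p.1 p.2.

(** A new first letter either lengthens the first run by one or opens a run of
length one; [L k 0 = 0] makes both cases read the same. *)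
Lemma run_sum_cons k v :
  run_sum (k :: v) = run_sum v + (L k (first_run k v).+1 - L k (first_run k v)).
Proof.
rewrite /run_sum /first_run /=; case: (runs v) => [|[l j] r].
  by rewrite big_seq1 big_nil L0 subr0 add0r.
case: eqP => [->|_] /=; rewrite !big_cons /=; first by ring.
by rewrite L0; ring.
Qed.

Lemma words_count q : (n - 1) * (\sum_(w <- words q) 1) + 1 = n ^+ q.+1.
Proof.
elim: q => [|q IH]; first by rewrite big_seq1; ring.
by rewrite sum_wordsS sumr_const cardT -cardE exprS -IH -mulr_natl; ring.
Qed.

(** Removing the first letter: only the words starting with [k] have a first run
to shorten, so [g] gets shifted for them, while all others contribute [g 0]. The
number of the latter, together with the empty word, is [n ^+ q.+1] by
[words_count]. *)
Lemma sum_first_run k q (g : nat -> F) :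
  \sum_(v <- words q) g (first_run k v) = \sum_(j < q.+1) n ^+ (q - j) * g j.
Proof.
elim: q g => [|q IH] g; first by rewrite big_seq1 big_ord1 mul1r.
rewrite sum_wordsS big_ord_recl subn0 -words_count.
(* the first letter is [k], or one of the [n - 1] others *)
rewrite (bigD1 k) //=.
under eq_bigr do rewrite first_run_cons eqxx.
rewrite (IH (g \o S)) /=.
under [X in _ + (_ + X)]eq_bigr => l kl.
  under eq_bigr do rewrite first_run_cons eq_sym (negbTE kl).
  over.
rewrite sumr_const cardC1.
have -> : \sum_(w <- words q) g 0%N = (\sum_(w <- words q) 1) * g 0%N.
  by rewrite mulr_suml; apply: eq_bigr => ? _; rewrite mul1r.
have -> : n = (#|T|.-1)%:R + 1 by rewrite natr1 prednK //; apply/card_gt0P; exists k.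
by rewrite -mulr_natl; ring.
Qed.

End Sums.
End Words.

Section Totals.
Variables (F : fieldType) (T : finType) (L : T -> nat -> F).
Hypothesis L0 : forall k, L k 0 = 0.
Local Notation n := (#|T|%:R : F).
Hypothesis n_neq0 : n != 0.

Definition weighted_sum (q : nat) : F := \sum_k \sum_(1 <= j < q.+1) L k j * n ^- j.

(** Let [d_q] be the left-hand side and [s_q = n^q * weighted_sum q]. By
[run_sum_cons] and [sum_first_run] applied to the increments of [L k], peeling off
the first letter gives [d_(q+1) = n d_q + s_(q+1) - s_q], and dividing by
[n^(q+1)] makes this recursion telescope. *)
Lemma sum_run_sum q :
  \sum_(w <- words T q) run_sum L w =
  n ^+ q * (weighted_sum q + (n - 1) / n * \sum_(m < q) weighted_sum m).
Proof.
elim: q => [|q IH].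
  rewrite big_seq1 /run_sum big_nil big_ord0 /weighted_sum big1 ?mulr0 ?addr0 ?mulr0 //.
  by move=> k _; rewrite big_geq.
rewrite sum_wordsS.
have -> : run_sum L [::] = 0 by rewrite /run_sum big_nil.
rewrite add0r.
under eq_bigr => k _.
  under eq_bigr do rewrite run_sum_cons //.
  rewrite big_split /= (sum_first_run _ _ (fun j => L k j.+1 - L k j)) IH.
  over.
rewrite big_split /= sumr_const cardT -cardE -[X in X + _]mulr_natl.
have -> : \sum_k \sum_(j < q.+1) n ^+ (q - j) * (L k j.+1 - L k j)
   = n ^+ q.+1 * weighted_sum q.+1 - n ^+ q * weighted_sum q.
  rewrite !mulr_sumr -sumrB; apply: eq_bigr => k _.
  rewrite !mulr_sumr.
  have e p : \sum_(1 <= j < p.+1) n ^+ p * (L k j * n ^- j) = \sum_(j < p.+1) n ^+ (p - j) * L k j.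
    rewrite -(big_mkord predT (fun j => n ^+ (p - j) * L k j)) [RHS]big_ltn // L0 mulr0 add0r.
    apply: eq_big_nat => j /andP[_ jp].
    by rewrite mulrCA mulrC -expfB_cond ?(negbTE n_neq0).
  rewrite !e [X in _ = X - _]big_ord_recl L0 mulr0 add0r -sumrB.
  by apply: eq_bigr => j _; rewrite subSS mulrBr.
rewrite big_ord_recr /= !exprS.
by field.
Qed.

End Totals.

(** * Limits *)

Section Limits.
Variable R : realType.

(** Apart from [u q / q], which is negligible or eventually nonpositive, this is
[c] times a Cesaro mean of [u]. When the limit is [-oo], truncating [u] from
below at a level [B] reduces the claim to the Cesaro theorem for a finite
limit. *)
Lemma cesaro_combination (u : nat -> R) (l : \bar R) (c : R) :
  0 < c -> (l < +oo)%E -> (u q)%:E @[q --> \oo] --> l ->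
  ((u q + c * \sum_(m < q) u m) / q%:R)%:E @[q --> \oo] --> (c%:E * l)%E.
Proof.
move=> c0 loo ul; rewrite -cvg_shiftS /=.
have -> : (fun q => ((u q.+1 + c * \sum_(m < q.+1) u m) / q.+1%:R)%:E)
    = (fun q => (u q.+1 * harmonic q + c * arithmetic_mean u q)%:E).
  apply/funext => q; congr (_%:E).
  by rewrite /arithmetic_mean /harmonic /series /= big_mkord; ring.
have uSl : (u q.+1)%:E @[q --> \oo] --> l by rewrite (cvg_shiftS (fun q => (u q)%:E)).
case: l loo ul uSl => [r _|//|_] ul uSl.
  have {}ul : u @ \oo --> r by move/fine_cvgP: ul => [].
  have {}uSl : u q.+1 @[q --> \oo] --> r by move/fine_cvgP: uSl => [].
  apply: cvg_EFin; first by apply: nearW.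
  have -> : c * r = r * 0 + c * r by rewrite mulr0 add0r.
  apply: cvgD; first by apply: cvgM => //; exact: cvg_harmonic.
  by apply: cvgM; [exact: cvg_cst | exact: cesaro].
rewrite gt0_muleNy ?lte_fin //; apply/cvgeNyPle => A.
move/cvgeNyPle: uSl => uSl.
(* the truncated means tend to [B], hence are eventually at most [A / c] *)
pose B := A / c - 1; pose t m := Num.max (u m) B.
have tB : t @ \oo --> B.
  apply: cvg_near_cst; move/cvgeNyPle: ul => /(_ B); apply: filterS => m.
  by rewrite lee_fin => /max_idPr.
have mB : \forall q \near \oo, arithmetic_mean t q <= A / c.
  by apply: (cvgr_le _ (cesaro tB)); rewrite /B; lra.
have := uSl 0; move: mB; apply: filterS2 => q mB; rewrite !lee_fin => u0.
have h1 : u q.+1 * harmonic q <= 0.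
  by rewrite mulr_le0_ge0 // /harmonic /= invr_ge0.
have h2 : arithmetic_mean u q <= A / c.
  apply: le_trans mB; rewrite /arithmetic_mean /= ler_wpM2l ?invr_ge0 //.
  by rewrite /series /=; apply: ler_sum => i _; rewrite /t le_max lexx.
have h3 : c * arithmetic_mean u q <= A.
  by rewrite mulrC -ler_pdivlMr.
by lra.
Qed.

Lemma cvg_sum_lty (I : Type) (s : seq I) (f : I -> nat -> \bar R) (l : I -> \bar R) :
  (forall i, (l i < +oo)%E) -> (forall i, f i q @[q --> \oo] --> l i) ->
  (\sum_(i <- s) f i q)%E @[q --> \oo] --> (\sum_(i <- s) l i)%E.
Proof.
move=> loo fl; elim: s => [|i s IH].
  by under eq_fun do rewrite big_nil; rewrite big_nil; exact: cvg_cst.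
under eq_fun do rewrite big_cons; rewrite big_cons; apply: cvgeD => //.
have : (\sum_(j <- s) l j < +oo)%E by apply: lte_sum_pinfty => j _; exact: loo.
have := loo i.
by case: (l i) => [?||]; case: (\sum_(j <- s) l j)%E => [?||].
Qed.

Lemma sum_arithgeo q :
  \sum_(1 <= j < q.+1) (j%:R / 2 ^+ j : R) = 2 - (q%:R + 2) / 2 ^+ q.
Proof.
elim: q => [|q IH]; first by rewrite big_geq // expr0 divr1; ring.
rewrite big_nat_recr //= IH -natr1 exprS.
by field.
Qed.

(** Subtracting the convergent majorant [c * j / 2^j] makes the partial sums
nonincreasing, so they have a limit, which is not [+oo]. *)
Lemma cvg_bounded_series (a : nat -> \bar R) (c : R) :
  0 <= c -> (forall j, (0 < j)%N -> a j <= (c * (j%:R / 2 ^+ j))%:E)%E ->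
  exists2 l, (l < +oo)%E & (\sum_(1 <= j < q) a j)%E @[q --> \oo] --> l.
Proof.
move=> c0 ac.
pose b j : R := c * (j%:R / 2 ^+ j).
have b0 j : 0 <= b j by rewrite /b !mulr_ge0 // invr_ge0 exprn_ge0.
pose B q := \sum_(1 <= j < q) b j.
have cB : cvgn B.
  apply: nondecreasing_is_cvgn.
    apply/nondecreasing_seqP => -[|q]; first by rewrite /B !big_geq.
    by rewrite /B [leRHS]big_nat_recr //= lerDl.
  exists (c * 2) => _ [q _ <-].
  have Bq p : B p.+1 <= c * 2.
    rewrite /B /b -mulr_sumr sum_arithgeo ler_wpM2l // gerBl.
    by rewrite divr_ge0 ?addr_ge0 // exprn_ge0.
  case: q => [|q]; last exact: Bq.
  by rewrite /B big_geq // mulr_ge0.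
pose V q := (\sum_(1 <= j < q) (a j - (b j)%:E))%E.
have nV : {homo V : p q / (p <= q)%N >-> (q <= p)%E}.
  apply/nonincreasing_seqP => -[|q]; first by rewrite /V !big_geq.
  rewrite /V [leLHS]big_nat_recr //= -[leRHS]adde0; apply: leeD2l.
  by rewrite EFinN leeBlDr // add0e; exact: ac.
have Vl := ereal_nonincreasing_cvgn nV.
set l := ereal_inf _ in Vl.
have loo : (l < +oo)%E.
  apply: (@le_lt_trans _ _ (V 0%N)); last by rewrite /V big_geq // ltry.
  by apply: ereal_inf_lbound; exists 0%N.
exists (l + (limn B)%:E)%E; first by rewrite lte_add_pinfty // ltry.
have -> : (fun q => \sum_(1 <= j < q) a j)%E = (fun q => V q + (B q)%:E)%E.
  apply/funext => q; rewrite /V /B -sumEFin -big_split /=.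
  by apply: eq_bigr => j _; rewrite EFinN subeK.
apply: cvgeD => //; last by apply: cvg_EFin => //; exact: nearW.
by case: (l) loo.
Qed.

Section RunDeterminant.
Variables (T : finType) (h : T -> nat -> R) (K : R).
Hypothesis h_ge0 : forall k j, 0 <= h k j.
Hypothesis h0 : forall k, h k 0 = 1.
Hypothesis K_ge1 : 1 <= K.
Hypothesis h_le : forall k j, h k j <= K ^+ j.
Hypothesis T_gt1 : (1 < #|T|)%N.

Definition run_prod (q : nat) : R := \prod_(w <- words T q) \prod_(p <- runs w) h p.1 p.2.

Let n_gt0 : 0 < #|T|%:R :> R.
Proof. by rewrite ltr0n ltnW. Qed.

(** When all [h k j] are positive, [sum_run_sum] turns the logarithm of the product
into the combination of [cesaro_combination]. When [h k j = 0], the word [k^j]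
makes the product vanish from [q = j] on, while the series of [k] contains the
term [-oo]. *)
Lemma run_prod_cvg :
  (lne (run_prod q)%:E * ((q%:R * #|T|%:R ^+ q)^-1)%:E)%E @[q --> \oo] -->
  (((#|T|%:R - 1) / #|T|%:R)%:E *
    \sum_k \sum_(1 <= j <oo) lne (h k j)%:E * (#|T|%:R ^- j)%:E)%E.
Proof.
set n : R := #|T|%:R.
have c0 : 0 < (n - 1) / n by rewrite divr_gt0 // subr_gt0 ltr1n.
pose a k j := (lne (h k j)%:E * (n ^- j)%:E)%E.
have n_exp_gt0 j : 0 < n ^- j by rewrite invr_gt0 exprn_gt0.
have a_le k j : (0 < j)%N -> (a k j <= (ln K * (j%:R / 2 ^+ j))%:E)%E.
  move=> j0; rewrite /a /=; case: ifP => [_|/negbT].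
    by rewrite gt0_mulNye ?lte_fin // leNye.
  rewrite -ltNge => hj; rewrite -EFinM lee_fin.
  apply: (@le_trans _ _ ((ln K *+ j) * n ^- j)).
    rewrite ler_wpM2r ?(ltW (n_exp_gt0 _)) // -lnXn ?(lt_le_trans _ K_ge1) //.
    by rewrite ler_ln ?posrE ?exprn_gt0 ?(lt_le_trans _ K_ge1).
  rewrite -[ln K *+ j]mulr_natr -[X in X <= _]mulrA.
  apply: ler_wpM2l; rewrite ?ln_ge0 //.
  apply: ler_wpM2l; rewrite // lef_pV2 ?posrE ?exprn_gt0 //.
  by apply: lerXn2r; rewrite ?nnegrE ?(ltW n_gt0) // /n (ler_nat _ 2).
have K0 : 0 <= ln K by rewrite ln_ge0.
have aE k : (limn (fun q => \sum_(1 <= j < q) a k j) < +oo)%E /\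
   (\sum_(1 <= j < q) a k j)%E @[q --> \oo] --> (\sum_(1 <= j <oo) a k j)%E.
  have [l loo al] := cvg_bounded_series K0 (a_le k).
  by rewrite (cvg_lim _ al).
have [hpos|] := pselect (forall k j, 0 < h k j).
  pose L k j := ln (h k j).
  have L0 k : L k 0%N = 0 by rewrite /L h0 ln1.
  have Sl : (weighted_sum L q)%:E @[q --> \oo] --> (\sum_k \sum_(1 <= j <oo) a k j)%E.
    have -> : (fun q => (weighted_sum L q)%:E) = (fun q => \sum_k \sum_(1 <= j < q.+1) a k j)%E.
      apply/funext => q; rewrite /weighted_sum -sumEFin; apply: eq_bigr => k _.
      rewrite -sumEFin; apply: eq_bigr => j _.
      by rewrite /a /= leNgt hpos.
    rewrite (cvg_shiftS (fun q => \sum_k \sum_(1 <= j < q) a k j)%E).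
    by apply: cvg_sum_lty => k; have [] := aE k.
  have Slt : ((\sum_k \sum_(1 <= j <oo) a k j) < +oo)%E.
    by apply: lte_sum_pinfty => k _; have [] := aE k.
  apply: cvg_trans (cesaro_combination c0 Slt Sl); apply: near_eq_cvg.
  near=> q; have q0 : (0 < q)%N by near: q; exists 1%N.
  have pos w : 0 < \prod_(p <- runs w) h p.1 p.2 by apply: prodr_gt0.
  rewrite lne_EFin ?prodr_gt0 // -EFinM; congr (_%:E).
  have -> : ln (run_prod q) = \sum_(w <- words T q) run_sum L w.
    rewrite /run_prod.
    elim: (words T q) => [|w s IH]; first by rewrite !big_nil ln1.
    rewrite !big_cons lnM ?posrE ?prodr_gt0 // IH; congr (_ + _).
    rewrite /run_sum.
    elim: (runs w) => [|p r IH']; first by rewrite !big_nil ln1.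
    by rewrite !big_cons lnM ?posrE ?prodr_gt0 // IH'.
  rewrite sum_run_sum ?gt_eqF // -/n; field.
  by rewrite expf_neq0 ?pnatr_eq0 -?lt0n ?q0 ?(gt_eqF n_gt0) ?(ltnW T_gt1).
move/existsNP => [k /existsNP[j hkj]].
have {}hkj : h k j = 0 by apply/le_anti; rewrite h_ge0 leNgt; move/negP: hkj => ->.
have j0 : (0 < j)%N by case: j hkj => // /eqP; rewrite h0 oner_eq0.
have akj : a k j = -oo%E by rewrite /a hkj /= lexx gt0_mulNye ?lte_fin.
have -> : (\sum_k \sum_(1 <= j <oo) a k j)%E = -oo%E.
  apply/eqP; rewrite esum_eqNy; apply/existsP; exists k; rewrite andTb.
  apply/eqP/cvg_lim => //; apply: cvg_near_cst; exists j.+1 => // q /= jq.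
  by apply/esum_eqNyP; exists j; rewrite mem_index_iota j0 jq.
rewrite gt0_muleNy ?lte_fin //.
apply: cvg_near_cst; exists j => // q /= jq.
have -> : run_prod q = 0.
  rewrite /run_prod (big_rem (nseq j k)) /= ?mem_words ?size_nseq //.
  by case: (j) j0 hkj => // i _; rewrite runs_nseq big_seq1 /= => ->; rewrite mul0r.
rewrite /= lexx gt0_mulNye // lte_fin invr_gt0 mulr_gt0 ?exprn_gt0 // ltr0n.
exact: leq_trans jq.
Unshelve. all: by end_near. Qed.

End RunDeterminant.
End Limits.

(** * Adjoints and von Neumann algebras *)

Section Adjoints.
Variables (R : realType) (H : completeNormedModType R[i]).
Variable dot : {dot H for @Num.conj R[i]}.
Implicit Types (a b : H -> H) (c : R[i]).

Local Notation adj := (adj dot).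
Local Notation is_adjoint := (is_adjoint dot).

Lemma lin_opE c a b u : (c *: a + b) u = c *: a u + b u.
Proof. by []. Qed.

Lemma dotC u v : dot v u = (dot u v)^*.
Proof. by rewrite [LHS]hermC /= expr0 mul1r. Qed.

Lemma is_adjoint_unique a b b' : is_adjoint a b -> is_adjoint a b' -> b = b'.
Proof.
move=> ab ab'; apply/funext => v; apply/eqP; rewrite -subr_eq0 -(dnorm_eq0 dot).
by rewrite linearBr /= -ab -ab' subrr.
Qed.

Lemma adj_eq a b : is_adjoint a b -> adj a = b.
Proof.
move=> ab; apply: (@is_adjoint_unique a) => //.
by apply: (@xgetPex _ 0 [set b | is_adjoint a b]); exists b.
Qed.

Lemma is_adjoint_sym a b : is_adjoint a b -> is_adjoint b a.
Proof. by move=> ab u v; rewrite dotC -ab -dotC. Qed.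

Lemma is_adjoint_comp a a' b b' :
  is_adjoint a a' -> is_adjoint b b' -> is_adjoint (a \o b) (b' \o a').
Proof. by move=> aa bb u v; rewrite /= aa bb. Qed.

Lemma is_adjoint_lin c a a' b b' :
  is_adjoint a a' -> is_adjoint b b' -> is_adjoint (c *: a + b) (c^* *: a' + b').
Proof.
move=> aa bb u v.
rewrite !lin_opE linearDl linearDr linearZl_LR linearZr_LR /=.
by rewrite conjCK aa bb.
Qed.

Section Algebra.
Variable N : set (H -> H).
Hypothesis hN : von_neumann_algebra dot N.

Lemma vna_bounded a : N a -> bounded_operator a.
Proof. by rewrite -hN.2 => -[]. Qed.

Lemma vna_linear a : N a -> linear a.
Proof. by move/vna_bounded => []. Qed.

Lemma vna_adjP a : N a -> N (adj a) /\ is_adjoint a (adj a).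
Proof. by move=> /hN.1 [b Nb ab]; rewrite (adj_eq ab). Qed.

Lemma vna_adj a : N a -> N (adj a).
Proof. by case/vna_adjP. Qed.

Lemma vna_id : N idfun.
Proof.
rewrite -hN.2; split=> //; split; first by [].
by exists 1 => u; rewrite mul1r.
Qed.

(** On the zero space any [k] bounds [a], so nonnegativity is not automatic. *)
Lemma bounded_operator_ge0 a : bounded_operator a ->
  exists2 k : R[i], 0 <= k & forall u, `|a u| <= k * `|u|.
Proof.
move=> [_ [k ak]]; exists `|k| => // u.
have : 0 <= k * `|u| by exact: le_trans (ak u).
by move=> /ger0_norm kE; rewrite (le_trans (ak u)) // -{1}kE normrM normr_id.
Qed.

Lemma vna_comp a b : N a -> N b -> N (a \o b).
Proof.
move=> Na Nb; have [la _] := vna_bounded Na; have [lb _] := vna_bounded Nb.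
have [k k0 ak] := bounded_operator_ge0 (vna_bounded Na).
have [k' k'0 bk] := bounded_operator_ge0 (vna_bounded Nb).
move: Na Nb; rewrite -hN.2 => -[_ ca] [_ cb].
split.
  split; first by move=> c u v /=; rewrite lb la.
  exists (k * k') => u; apply: le_trans (ak _) _.
  by rewrite -mulrA ler_wpM2l.
move=> d Nd; change (d \o (a \o b)) with ((d \o a) \o b); rewrite (ca d Nd).
by change (a \o (d \o b) = a \o (b \o d)); rewrite (cb d Nd).
Qed.

Lemma vna_lin c a b : N a -> N b -> N (c *: a + b).
Proof.
move=> Na Nb; have [la _] := vna_bounded Na; have [lb _] := vna_bounded Nb.
have [k k0 ak] := bounded_operator_ge0 (vna_bounded Na).
have [k' k'0 bk] := bounded_operator_ge0 (vna_bounded Nb).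
move: Na Nb; rewrite -hN.2 => -[_ ca] [_ cb].
split.
  split.
    move=> d u v; rewrite !lin_opE la lb.
    by rewrite !scalerDr !scalerA [c * d]mulrC addrACA.
  exists (`|c| * k + k') => u; rewrite lin_opE mulrDl; apply: le_trans (ler_normD _ _) _.
  by apply: lerD => //; rewrite normrZ -mulrA ler_wpM2l.
move=> d Nd; have [ld _] := Nd.1.
apply/funext => u; rewrite /= lin_opE ld.
have := ca _ Nd => /(congr1 (fun f => f u)) /= ->.
by have := cb _ Nd => /(congr1 (fun f => f u)) /= ->.
Qed.

Lemma vna_zero : N 0.
Proof. by have := vna_lin (-1) vna_id vna_id; rewrite scaleN1r addNr. Qed.

Lemma vna_scale c a : N a -> N (c *: a).
Proof. by move=> Na; rewrite -[_ *: _]addr0; apply: vna_lin => //; exact: vna_zero. Qed.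

Lemma vna_add a b : N a -> N b -> N (a + b).
Proof. by move=> Na; rewrite -[a in a + b]scale1r; exact: vna_lin. Qed.

Lemma vna_sub a b : N a -> N b -> N (a - b).
Proof. by move=> Na Nb; rewrite addrC -scaleN1r; exact: vna_lin. Qed.

Lemma vna_sum (I : Type) (s : seq I) (P : pred I) (F : I -> H -> H) :
  (forall i, P i -> N (F i)) -> N (\sum_(i <- s | P i) F i).
Proof. by move=> NF; elim/big_ind: _ => //; [exact: vna_zero | exact: vna_add]. Qed.

Lemma vna_iter a j : N a -> N (iter j a).
Proof. by move=> Na; elim: j => [|j IH]; [exact: vna_id | exact: vna_comp]. Qed.

Lemma vna_op_prod (I : eqType) (s : seq I) (y : I -> H -> H) :
  (forall i, i \in s -> N (y i)) -> N (op_prod s y).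
Proof.
rewrite /op_prod; elim: s => [|i s IH] Ny; first by rewrite big_nil; exact: vna_id.
rewrite big_cons; apply: vna_comp; first by apply: Ny; rewrite mem_head.
by apply: IH => k ks; apply: Ny; rewrite inE ks orbT.
Qed.

Lemma adj_comp a b : N a -> N b -> adj (a \o b) = adj b \o adj a.
Proof.
by move=> /vna_adjP[_ ?] /vna_adjP[_ ?]; apply: adj_eq; exact: is_adjoint_comp.
Qed.

Lemma adj_lin c a b : N a -> N b -> adj (c *: a + b) = c^* *: adj a + adj b.
Proof.
by move=> /vna_adjP[_ ?] /vna_adjP[_ ?]; apply: adj_eq; exact: is_adjoint_lin.
Qed.

Lemma adj_id : adj idfun = idfun.
Proof. exact: adj_eq. Qed.

Lemma comp_linr c a b b' : N a -> a \o (c *: b + b') = c *: (a \o b) + (a \o b').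
Proof. by move=> Na; apply/funext => u; rewrite /= !lin_opE (vna_linear Na). Qed.

End Algebra.

Lemma comp_linl c a a' b : (c *: a + a') \o b = c *: (a \o b) + (a' \o b).
Proof. by []. Qed.

Lemma op_prod_cons (I : Type) i (s : seq I) (y : I -> H -> H) :
  op_prod (i :: s) y = y i \o op_prod s y.
Proof. by rewrite /op_prod big_cons. Qed.

Lemma op_prod_cat (I : Type) (s s' : seq I) (y : I -> H -> H) :
  op_prod (s ++ s') y = op_prod s y \o op_prod s' y.
Proof.
elim: s => [|i s IH] /=; first by rewrite [in RHS]/op_prod big_nil.
by rewrite !op_prod_cons IH.
Qed.

Lemma op_prod_nseq (I : Type) i j (y : I -> H -> H) : op_prod (nseq j i) y = iter j (y i).
Proof.
elim: j => [|j IH]; first by rewrite /op_prod big_nil.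
by rewrite op_prod_cons IH.
Qed.

Lemma vn_generated_mem (x : H -> H) : vn_generated dot x x.
Proof. by []. Qed.

End Adjoints.

(** * The inner product of the trace *)

Section L2.
Variables (R : realType) (H : completeNormedModType R[i]).
Variable dot : {dot H for @Num.conj R[i]}.
Variables (M : set (H -> H)) (tau : (H -> H) -> R[i]).
Hypothesis hM : free_probability_space dot M tau.
Implicit Types (a b : H -> H) (c : R[i]).

Local Notation adj := (adj dot).
Local Notation ip := (l2dot dot tau).

Let hV : von_neumann_algebra dot M := fps_vna hM.

Lemma tau0 : tau 0 = 0.
Proof.
have M1 := vna_id hV.
by have := fps_linear hM (-1) M1 M1; rewrite scaleN1r addNr mulN1r addNr.
Qed.

Lemma l2dotPl c a b e : M a -> M b -> M e -> ip (c *: a + b) e = c * ip a e + ip b e.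
Proof.
move=> Ma Mb Me; have Me' := vna_adj hV Me.
by rewrite /l2dot (comp_linr hV) // (fps_linear hM) //; apply: (vna_comp hV).
Qed.

Lemma l2dotPr c a b e : M a -> M b -> M e -> ip e (c *: a + b) = c^* * ip e a + ip e b.
Proof.
move=> Ma Mb Me; have Ma' := vna_adj hV Ma; have Mb' := vna_adj hV Mb.
by rewrite /l2dot (adj_lin hV) // comp_linl (fps_linear hM) //; apply: (vna_comp hV).
Qed.

Lemma l2dot_ge0 a : M a -> 0 <= ip a a.
Proof. exact: fps_positive. Qed.

(** Polarization: positivity of the form at [a + b] and at ['i a + b] says that
[ip a b + ip b a] and ['i (ip a b - ip b a)] are real. *)
Lemma l2dotC a b : M a -> M b -> ip b a = (ip a b)^*.
Proof.
move=> Ma Mb.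
have sq c : 0 <= ip (c *: a + b) (c *: a + b) by apply: l2dot_ge0; apply: (vna_lin hV).
have expand c : ip (c *: a + b) (c *: a + b) =
    c * c^* * ip a a + c * ip a b + c^* * ip b a + ip b b.
  rewrite l2dotPl ?l2dotPr //; try by apply: (vna_lin hV).
  by rewrite mulrDr !mulrA !addrA.
have Ra : (ip a a)^* = ip a a by apply/CrealP/ger0_real/l2dot_ge0.
have Rb : (ip b b)^* = ip b b by apply/CrealP/ger0_real/l2dot_ge0.
have /CrealP e1 := ger0_real (sq 1).
have /CrealP ei := ger0_real (sq 'i).
move: e1 ei; rewrite !expand !rmorphD !rmorphM /= !conjCK Ra Rb conjC1 conjCi.
move: (ip a b) (ip b a) (ip a a) (ip b b) => z w p r e1 ei.
have {}e1 : z^* + w^* = z + w.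
  by apply: (addrI p); apply: (addIr r); move: e1; rewrite !mul1r !addrA.
have i0 : 'i != 0 :> R[i] by rewrite neq0Ci.
have {}ei : w^* - z^* = z - w.
  apply: (mulfI i0); move/eqP: ei; rewrite -subr_eq0 => /eqP ei.
  by apply/eqP; rewrite -subr_eq0 -ei; apply/eqP; ring.
have : 2 * z^* = 2 * w.
  have -> : 2 * z^* = (z^* + w^*) - (w^* - z^*) by ring.
  by rewrite e1 ei; ring.
have two0 : (2 : R[i]) != 0 by rewrite pnatr_eq0.
by move/(mulfI two0) => ->.
Qed.

Lemma l2dot_eq0 a : M a -> ip a a = 0 -> a = 0.
Proof. exact: fps_faithful. Qed.

Lemma l2dot0l b : M b -> ip 0 b = 0.
Proof.
move=> Mb; have M0 := vna_zero hV.
by have := l2dotPl (-1) Mb Mb Mb; rewrite scaleN1r addNr mulN1r addNr.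
Qed.

Lemma l2dotZl c a b : M a -> M b -> ip (c *: a) b = c * ip a b.
Proof.
by move=> Ma Mb; rewrite -[c *: a]addr0 l2dotPl ?l2dot0l ?addr0 //; exact: (vna_zero hV).
Qed.

Lemma l2dotDl a b e : M a -> M b -> M e -> ip (a + b) e = ip a e + ip b e.
Proof. by move=> Ma Mb Me; rewrite -[a in a + b]scale1r l2dotPl // mul1r. Qed.

Lemma l2dotDr a b e : M a -> M b -> M e -> ip e (a + b) = ip e a + ip e b.
Proof. by move=> Ma Mb Me; rewrite -[a in a + b]scale1r l2dotPr // conjC1 mul1r. Qed.

Lemma l2dotZr c a b : M a -> M b -> ip b (c *: a) = c^* * ip b a.
Proof.
move=> Ma Mb; rewrite l2dotC ?l2dotZl //; last exact: (vna_scale hV).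
by rewrite rmorphM /= -l2dotC.
Qed.

Lemma l2dot_suml (I : Type) (s : seq I) (F : I -> H -> H) b :
  (forall i, M (F i)) -> M b -> ip (\sum_(i <- s) F i) b = \sum_(i <- s) ip (F i) b.
Proof.
move=> MF Mb; elim: s => [|i s IH]; first by rewrite !big_nil l2dot0l.
by rewrite !big_cons l2dotDl ?IH //; apply: (vna_sum hV).
Qed.

Lemma l2dot_sumr (I : Type) (s : seq I) (F : I -> H -> H) b :
  (forall i, M (F i)) -> M b -> ip b (\sum_(i <- s) F i) = \sum_(i <- s) ip b (F i).
Proof.
move=> MF Mb; rewrite l2dotC // ?l2dot_suml //; last by apply: (vna_sum hV).
by rewrite rmorph_sum; apply: eq_bigr => i _; rewrite /= -l2dotC.
Qed.

Lemma tau_l2dot a : tau a = ip a idfun.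
Proof. by rewrite /l2dot adj_id. Qed.

Lemma l2norm_sqr a : M a -> (l2norm dot tau a ^+ 2)%:C%C = ip a a.
Proof.
move=> Ma; have := l2dot_ge0 Ma; rewrite lecE /= => /andP[/eqP im0 re0].
by rewrite /l2norm sqr_sqrtr //; apply/eqP; rewrite eq_complex /= im0 !eqxx.
Qed.

(** The set [{a, b}] is directed with supremum [b], so normality makes [tau b] an
upper bound of [tau a]. This avoids writing [b - a] as a square, which would take
functional calculus. *)
Lemma tau_le a b : M a -> M b -> is_adjoint dot a a -> is_adjoint dot b b ->
  op_le dot a b -> tau a <= tau b.
Proof.
move=> Ma Mb aa bb ab.
have bb0 : op_le dot b b by move=> u; rewrite subrr linear0l.
have [] := @fps_normal _ _ _ _ _ hM [set y | y = a \/ y = b] b.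
- by exists b; right.
- by move=> y [->|->].
- by move=> y [->|->].
- by move=> y z yab zab; exists b; split; [right|case: yab => ->|case: zab => ->].
- by split=> // [y [->|->] //|y _ Ay]; apply: Ay; right.
by move=> _ + _; apply; exists a => //; left.
Qed.

Definition span (v : nat -> H -> H) (j : nat) : set (H -> H) :=
  [set a | exists c : 'I_j -> R[i], a = \sum_(i < j) c i *: v i].

Lemma span_vna (N : set (H -> H)) (v : nat -> H -> H) j :
  von_neumann_algebra dot N -> (forall i, N (v i)) -> span v j `<=` N.
Proof. by move=> hN Nv _ [c ->]; apply: (vna_sum hN) => i _; apply: (vna_scale hN). Qed.

Lemma spanS v j s c : span v j s -> span v j.+1 (s + c *: v j).
Proof.
move=> [d ->]; exists (fun i => if unlift ord_max i is Some i' then d i' else c).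
rewrite big_ord_recr /= unlift_none; congr (_ + _); apply: eq_bigr => i _.
have -> : widen_ord (leqnSn j) i = lift ord_max i.
  by apply/val_inj; rewrite /= /bump leqNgt ltn_ord.
by rewrite liftK.
Qed.

Lemma span_recr v j s : span v j.+1 s -> exists t c, span v j t /\ s = t + c *: v j.
Proof.
move=> [d ->]; rewrite big_ord_recr /=.
exists (\sum_(i < j) d (widen_ord (leqnSn j) i) *: v i), (d ord_max); split=> //.
by exists (fun i => d (widen_ord (leqnSn j) i)).
Qed.

Lemma span_lin v j c s t : span v j s -> span v j t -> span v j (c *: s + t).
Proof.
move=> [d ->] [e ->]; exists (fun i => c * d i + e i).
rewrite scaler_sumr -big_split; apply: eq_bigr => i _.
by rewrite scalerDl scalerA.
Qed.

Lemma span_le v i j s : (i <= j)%N -> span v i s -> span v j s.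
Proof.
move=> /subnK <-; elim: (j - i)%N => // k IH /IH sS.
by rewrite -[s]addr0 -(scale0r (v (k + i)%N)); exact: spanS.
Qed.

(** Gram-Schmidt: with [w] the part of [v j] orthogonal to the span of its
predecessors, the projection gains the component along [w]. If [w] has norm
zero, it vanishes by faithfulness and nothing is added, in agreement with
division by zero giving zero. *)
Lemma span_projection v j a : (forall i, M (v i)) -> M a ->
  exists e, span v j e /\ forall s, span v j s -> ip (a - e) s = 0.
Proof.
move=> Mv; elim: j a => [|j IH] a Ma.
  exists 0; split; first by exists (fun=> 0); rewrite big_ord0.
  move=> _ [c ->]; rewrite big_ord0 subr0 l2dotC ?l2dot0l ?conjC0 //; exact: (vna_zero hV).
have spanM s : span v j s -> M s by exact: (span_vna hV).
have [f [fS fO]] := IH _ (Mv j); have Mf := spanM _ fS.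
have [e [eS eO]] := IH _ Ma; have Me := spanM _ eS.
set w := v j - f in fO.
have Mw : M w by exact: (vna_sub hV).
have vE : v j = w + f by rewrite /w subrK.
pose t := ip (a - e) w / ip w w.
exists ((- t) *: f + e + t *: v j); split; first by apply: spanS; exact: span_lin.
have -> : a - ((- t) *: f + e + t *: v j) = (- t) *: w + (a - e).
  rewrite /w scalerBr !scaleNr !opprD !opprK.
  by rewrite addrC [_ - e - _]addrAC -!addrA [- e + a]addrC addrCA.
have Mae : M (a - e) by exact: (vna_sub hV).
move=> _ /span_recr[s [c [sS ->]]].
have Ms := spanM _ sS.
have sO : ip ((- t) *: w + (a - e)) s = 0 by rewrite l2dotPl // fO // eO // mulr0 addr0.
have wO : ip ((- t) *: w + (a - e)) w = 0.
  rewrite l2dotPl // /t.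
  have [w0|w0] := eqVneq (ip w w) 0; last by rewrite mulNr divfK // addNr.
  have -> : w = 0 by exact: l2dot_eq0.
  have M0 := vna_zero hV.
  by rewrite [ip _ 0]l2dotC // !l2dot0l // conjC0 mulr0 addr0.
have fO' : ip ((- t) *: w + (a - e)) f = 0 by rewrite l2dotPl // fO // eO // mulr0 addr0.
have Mx : M ((- t) *: w + (a - e)) by exact: (vna_lin hV).
have -> : s + c *: v j = c *: w + (c *: f + s) by rewrite vE scalerDr addrCA [s + _]addrC.
rewrite !l2dotPr //; first by rewrite wO fO' sO !mulr0 !addr0.
exact: (vna_lin hV).
Qed.

Section Residual.
Variables (x : H -> H).
Hypothesis Mx : M x.

Lemma l2projP j :
  power_span x j (l2proj dot tau (power_span x j) (iter j x)) /\
  forall s, power_span x j s -> ip (power_residual dot tau x j) s = 0.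
Proof.
have [e eP] := @span_projection (fun i => iter i x) j (iter j x)
  (fun i => vna_iter hV i Mx) (vna_iter hV j Mx).
exact: (@xgetPex _ 0 [set e | power_span x j e /\
   forall s, power_span x j s -> ip (iter j x - e) s = 0] (ex_intro _ e eP)).
Qed.

Lemma residual_vna (N : set (H -> H)) j :
  von_neumann_algebra dot N -> N x -> N (power_residual dot tau x j).
Proof.
move=> hN Nx; apply: (vna_sub hN); first exact: (vna_iter hN).
have [S _] := l2projP j.
by apply: (@span_vna _ (fun i => iter i x) j) S => // i; exact: (vna_iter hN).
Qed.

Let MP j : M (power_residual dot tau x j) := residual_vna j hV Mx.

Lemma residual0 : power_residual dot tau x 0 = idfun.
Proof.
by rewrite /power_residual; case: (l2projP 0) => -[c ->] _; rewrite big_ord0 subr0.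
Qed.

Lemma iter_power_span i j : (i < j)%N -> power_span x j (iter i x).
Proof.
move=> ij; exists (fun k => if val k == i then 1 else 0).
rewrite (bigD1 (Ordinal ij)) //= eqxx scale1r big1 ?addr0 // => k.
by rewrite -val_eqE /= => /negbTE ->; rewrite scale0r.
Qed.

Lemma residual_lower i j : (i < j)%N ->
  ip (power_residual dot tau x j) (power_residual dot tau x i) = 0.
Proof.
move=> ij; have [_ O] := l2projP j; apply: O.
rewrite /power_residual addrC -scaleN1r; apply: (@span_lin (fun i => iter i x)).
  exact: (span_le (ltnW ij) (l2projP i).1).
exact: iter_power_span.
Qed.

Lemma residual_orthogonal i j : i != j ->
  ip (power_residual dot tau x i) (power_residual dot tau x j) = 0.
Proof.
rewrite neq_ltn => /orP[ij|ji]; last exact: residual_lower.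
by rewrite l2dotC // residual_lower // conjC0.
Qed.

Lemma residual_centered j : (0 < j)%N -> tau (power_residual dot tau x j) = 0.
Proof. by move=> j0; rewrite tau_l2dot -residual0 residual_lower. Qed.

Lemma residual_l2dot_le j :
  ip (power_residual dot tau x j) (power_residual dot tau x j) <= ip (iter j x) (iter j x).
Proof.
have [S O] := l2projP j.
set e := l2proj _ _ _ _ in S; set p := power_residual _ _ _ _ in O *.
have Mp : M p := MP j.
have Me : M e by apply: (span_vna (v := fun i => iter i x) hV _ S) => i; exact: (vna_iter hV).
have -> : iter j x = p + e by rewrite /p /power_residual subrK.
have Mpe := vna_add hV Mp Me.
rewrite (l2dotDl Mp Me Mpe) (l2dotDr Mp Me Mp) (l2dotDr Mp Me Me).
by rewrite (l2dotC Mp Me) (O _ S) conjC0 addr0 add0r lerDl l2dot_ge0.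
Qed.

Variable K : R[i].
Hypothesis K0 : 0 <= K.
Hypothesis xK : forall u, `|x u| <= K * `|u|.

(** The operator inequality [(x a)^* (x a) <= K^2 a^* a] holds pointwise on [H],
and [tau] preserves it. *)
Lemma l2dot_comp_le a : M a -> ip (x \o a) (x \o a) <= K ^+ 2 * ip a a.
Proof.
move=> Ma; have Mxa := vna_comp hV Mx Ma.
have [Ma' aP] := vna_adjP hV Ma; have [Mxa' xaP] := vna_adjP hV Mxa.
have Mb := vna_comp hV Ma' Ma.
have -> : K ^+ 2 * ip a a = tau (K ^+ 2 *: (adj a \o a)).
  rewrite -[K ^+ 2 *: _]addr0 (fps_linear hM) //; last exact: (vna_zero hV).
  by rewrite tau0 addr0.
apply: tau_le; [exact: (vna_comp hV)|exact: (vna_scale hV)| | |].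
- by apply: is_adjoint_comp => //; exact: is_adjoint_sym.
- move=> u v; rewrite /GRing.scale /= linearZl_LR linearZr_LR /=.
  rewrite conj_Creal ?ger0_real ?exprn_ge0 //; congr (_ * _).
  have := is_adjoint_comp (is_adjoint_sym aP) aP; exact.
move=> u.
have -> : (K ^+ 2 *: (adj a \o a)) u = K ^+ 2 *: adj a (a u) by [].
have dotE s t (y : H -> H) : is_adjoint dot y (adj y) -> dot (adj y s) t = dot s (y t).
  by move=> yP; rewrite (is_adjoint_sym yP).
rewrite linearBl /= linearZl_LR /= !dotE // subr_ge0.
by rewrite !(fps_hilbert hM) -exprMn lerXn2r ?nnegrE ?mulr_ge0.
Qed.

Lemma iter_l2dot_le j : ip (iter j x) (iter j x) <= K ^+ 2 ^+ j.
Proof.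
elim: j => [|j IH]; first by rewrite expr0 /l2dot adj_id (fps_unit hM).
rewrite exprS; apply: le_trans (l2dot_comp_le (vna_iter hV j Mx)) _.
by rewrite ler_wpM2l ?exprn_ge0.
Qed.

End Residual.
End L2.

(** * Freeness *)

(** [catrev s t] runs through [s] backwards and then through [t], which is the shape
of the factors of [adj (op_prod s) \o op_prod t]. *)
Lemma sorted_catrev (T : Type) (e : rel T) (s t : seq T) :
  symmetric e -> sorted e s -> sorted e t ->
  (if s is p :: _ then if t is q :: _ then e p q else true else true) ->
  sorted e (catrev s t).
Proof.
move=> e_sym; elim: s t => //= p s IH t es et pt; apply: IH.
- exact: path_sorted es.
- by case: t et pt => //= q t -> ->.
- by case: s es => //= q s /andP[pq _]; rewrite e_sym.
Qed.

Section Freeness.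
Variables (R : realType) (H : completeNormedModType R[i]).
Variable dot : {dot H for @Num.conj R[i]}.
Variables (M : set (H -> H)) (tau : (H -> H) -> R[i]).
Hypothesis hM : free_probability_space dot M tau.
Let hV : von_neumann_algebra dot M := fps_vna hM.
Local Notation adj := (adj dot).
Local Notation ip := (l2dot dot tau).

Lemma vn_generated_sub (x : H -> H) : M x -> vn_generated dot x `<=` M.
Proof. by move=> Mx a; apply. Qed.

Lemma commutant_anti (S S' : set (H -> H)) : S `<=` S' -> commutant S' `<=` commutant S.
Proof. by move=> SS' a [ba ca]; split=> // b /SS' /ca. Qed.

(** An intersection of bicommutants is a bicommutant, as taking commutants
reverses inclusions. *)
Lemma vn_generated_vna (x : H -> H) : M x -> von_neumann_algebra dot (vn_generated dot x).
Proof.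
move=> Mx; split=> [a Na|].
  have [_ aP] := vna_adjP hV (vn_generated_sub Mx Na).
  by exists (adj a) => // N hN Nx; apply: (vna_adj hN); exact: Na.
apply/seteqP; split=> [a aN N hN Nx|a Na].
  rewrite -hN.2; apply: commutant_anti aN; apply: commutant_anti => b; exact.
split; first exact: (vna_bounded hV (vn_generated_sub Mx Na)).
by move=> b [_ cb]; rewrite cb.
Qed.

Variables (n : nat) (x : 'I_n -> H -> H).
Hypothesis Mx : forall k, M (x k).
Hypothesis hfree : free_elements dot tau x.
Local Notation N k := (vn_generated dot (x k)).
Local Notation P k j := (power_residual dot tau (x k) j).

Let hN k : von_neumann_algebra dot (N k) := vn_generated_vna (Mx k).

Lemma generated_in_algebra k a : N k a -> M a.
Proof. exact: vn_generated_sub. Qed.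

Local Notation prodl s := (op_prod s (fun p : 'I_n * (H -> H) => p.2)).
Local Notation alternating := (sorted (fun p q : 'I_n * _ => p.1 != q.1)).

(** Freeness restated for lists, which, unlike functions on [nat], can be
reversed and concatenated. *)
Lemma tau_alternating (s : seq ('I_n * (H -> H))) : s != [::] ->
  alternating s -> (forall p, p \in s -> N p.1 p.2 /\ tau p.2 = 0) ->
  tau (prodl s) = 0.
Proof.
case: s => // d s _ /(sortedP d) salt sP; set t := d :: s in salt sP *.
have := hfree (m := size t) (i := fun j => (nth d t j).1) (y := fun j => (nth d t j).2).
rewrite /op_prod -(big_map (nth d t) predT (fun p => p.2)) map_nth_iota0 // take_size.
apply=> // [j jt|j jt]; first by apply: sP; exact: mem_nth.
by apply/eqP; exact: salt.
Qed.

Lemma adj_prodl_comp (s t : seq ('I_n * (H -> H))) :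
  (forall p, p \in s -> M p.2) ->
  adj (prodl s) \o prodl t = prodl (catrev [seq (p.1, adj p.2) | p <- s] t).
Proof.
elim: s t => [|p s IH] t sM /=; first by rewrite [op_prod [::] _]/op_prod big_nil adj_id.
have Mp : M p.2 by apply: sM; rewrite mem_head.
have Ms q : q \in s -> M q.2 by move=> qs; apply: sM; rewrite inE qs orbT.
rewrite op_prod_cons (adj_comp hV) //; last exact: (vna_op_prod hV).
by rewrite -IH // op_prod_cons.
Qed.

Definition run_op (r : seq ('I_n * nat)) : H -> H := op_prod r (fun p => P p.1 p.2).

(* the letter is kept next to the residual, as freeness asks for it *)
Let tag (r : seq ('I_n * nat)) := [seq (p.1, P p.1 p.2) | p <- r].

Let run_opE r : run_op r = prodl (tag r).
Proof. by rewrite /run_op /op_prod big_map. Qed.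

Lemma residual_in_generated k j : N k (P k j).
Proof.
exact: (residual_vna hM (Mx k) j (hN k) (@vn_generated_mem _ _ _ (x k))).
Qed.

Lemma residual_in_algebra k j : M (P k j).
Proof. exact: (generated_in_algebra (@residual_in_generated k j)). Qed.

Lemma run_op_in_algebra r : M (run_op r).
Proof. by apply: (vna_op_prod hV) => p _; exact: residual_in_algebra. Qed.

Let tagM r p : p \in tag r -> M p.2.
Proof. by move=> /mapP[q _ ->]; exact: residual_in_algebra. Qed.

Let alternating_tag r : alternating (tag r) = alternating r.
Proof. by rewrite /tag sorted_map. Qed.

Let dagtag r := [seq (p.1, adj p.2) | p <- tag r].

Let alternating_dagtag r : alternating (dagtag r) = alternating r.
Proof. by rewrite /dagtag sorted_map -alternating_tag. Qed.

Lemma tau_adj a : M a -> tau (adj a) = (tau a)^*.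
Proof.
move=> Ma; rewrite [tau a](tau_l2dot dot tau) -(l2dotC hM) //; last exact: (vna_id hV).
Qed.

Let tag_centered r p : all (fun p => 0 < p.2)%N r -> p \in tag r -> N p.1 p.2 /\ tau p.2 = 0.
Proof.
move=> /allP r0 /mapP[q qr ->] /=; split; first exact: residual_in_generated.
by apply: (residual_centered hM (Mx _)); exact: r0.
Qed.

Let dagtag_centered r p : all (fun p => 0 < p.2)%N r -> p \in dagtag r -> N p.1 p.2 /\ tau p.2 = 0.
Proof.
move=> r0 /mapP[q qr ->] /=; have [Nq tq] := tag_centered r0 qr.
by split; [exact: (vna_adj (hN _)) | rewrite tau_adj ?tq ?conjC0 //; exact: generated_in_algebra Nq].
Qed.

(** The operator [adj (run_op r') \o run_op r] is a product of centered factors,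
alternating except where the first runs [p'] and [p] meet. If these have different
letters, freeness gives zero. If they have the same letter, split the product of
the two residuals into its centered part, to which freeness applies, and its
trace, which is zero unless [p' = p] and leaves the same problem for the
remaining runs. *)
Lemma run_op_l2dot (r r' : seq ('I_n * nat)) :
  alternating r -> alternating r' ->
  all (fun p => 0 < p.2)%N r -> all (fun p => 0 < p.2)%N r' ->
  ip (run_op r) (run_op r') =
  if r == r' then \prod_(p <- r) ip (P p.1 p.2) (P p.1 p.2) else 0.
Proof.
have symn : symmetric (fun p q : 'I_n * (H -> H) => p.1 != q.1) by move=> p q; rewrite eq_sym.
(* freeness settles the cases where the first runs differ in letter or exactly
   one of the lists is empty *)
have key r1 r2 : alternating r1 -> alternating r2 ->
    all (fun p => 0 < p.2)%N r1 -> all (fun p => 0 < p.2)%N r2 ->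
    (if r2 is p :: _ then if r1 is q :: _ then p.1 != q.1 else true else r1 != [::]) ->
    ip (run_op r1) (run_op r2) = 0.
  move=> a1 a2 g1 g2 h12; rewrite /l2dot !run_opE adj_prodl_comp; last exact: tagM.
  apply: tau_alternating.
  - by rewrite -size_eq0 catrevE size_cat size_rev; case: (r1) (r2) h12 => [|? ?] [].
  - apply: sorted_catrev => //; rewrite ?alternating_dagtag ?alternating_tag //.
    by case: (r1) (r2) h12 => [|? ?] [].
  move=> p; rewrite catrevE mem_cat mem_rev => /orP[].
    exact: dagtag_centered.
  exact: tag_centered.
elim: r r' => [|p r IH] [|p' r'] ra ra' r0 r0'.
- by rewrite eqxx big_nil /l2dot /run_op /op_prod big_nil adj_id (fps_unit hM).
- by rewrite key.
- by rewrite key.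
have [pp|pp] := eqVneq p'.1 p.1; last first.
  rewrite key //; case: eqP => // -[pp' _].
  by rewrite pp' eqxx in pp.
move: r0 r0' => /= /andP[p0 r0] /andP[p0' r0'].
have sr : alternating r := path_sorted ra.
have sr' : alternating r' := path_sorted ra'.
have Mr := run_op_in_algebra r; have Mr' := run_op_in_algebra r'.
have Mp := residual_in_algebra p.1 p.2; have Mp' := residual_in_algebra p'.1 p'.2.
set c := ip (P p.1 p.2) (P p'.1 p'.2).
(* the centered part of the product of the two residuals that meet *)
pose a := (adj (P p'.1 p'.2) \o P p.1 p.2) - c *: idfun.
have Na : N p.1 a.
  apply: (vna_sub (hN _)); last by apply: (vna_scale (hN _)); exact: (vna_id (hN _)).
  apply: (vna_comp (hN _)); last exact: residual_in_generated.
  by rewrite -pp; apply: (vna_adj (hN _)); exact: residual_in_generated.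
have Ma := generated_in_algebra Na; have M1 := vna_id hV.
have ta : tau a = 0.
  rewrite /a addrC -scaleNr (fps_linear hM) //; last exact: (vna_comp hV (vna_adj hV Mp') Mp).
  by rewrite (fps_unit hM) mulr1 -/(l2dot _ _ _ _) -/c addNr.
have -> : ip (run_op (p :: r)) (run_op (p' :: r')) =
    tau (adj (run_op r') \o (a \o run_op r)) + c * ip (run_op r) (run_op r').
  rewrite /l2dot /run_op !op_prod_cons -!/(run_op _) (adj_comp hV) //.
  have -> : (adj (run_op r') \o adj (P p'.1 p'.2)) \o (P p.1 p.2 \o run_op r)
     = c *: (adj (run_op r') \o run_op r) + (adj (run_op r') \o (a \o run_op r)).
    rewrite -(comp_linr hV) //; last exact: (vna_adj hV).
    have -> : c *: run_op r + (a \o run_op r) = (adj (P p'.1 p'.2) \o P p.1 p.2) \o run_op r.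
      by apply/funext => u; rewrite /a /= lin_opE /= addrC subrK.
    by [].
  rewrite (fps_linear hM) 1?addrC //; [exact: (vna_comp hV (vna_adj hV Mr') Mr)|].
  exact: (vna_comp hV (vna_adj hV Mr') (vna_comp hV Ma Mr)).
have -> : tau (adj (run_op r') \o (a \o run_op r)) = 0.
  have -> : a \o run_op r = prodl ((p.1, a) :: tag r) by rewrite op_prod_cons -run_opE.
  rewrite run_opE adj_prodl_comp; last exact: tagM.
  apply: tau_alternating.
  - by rewrite -size_eq0 catrevE size_cat addnS.
  - apply: sorted_catrev => //; first by rewrite alternating_dagtag.
      by move: ra; rewrite -alternating_tag /=; case: (r).
    move: ra'; rewrite /= -pp.
    by case: (r') => //= q ? /andP[]; rewrite eq_sym.
  move=> q; rewrite catrevE mem_cat mem_rev => /orP[|]; first exact: dagtag_centered.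
  by rewrite inE => /predU1P[->|] //; exact: tag_centered.
rewrite add0r IH // eqseq_cons big_cons.
have [->|rr] := eqVneq r r'; last by rewrite mulr0 andbF.
rewrite andbT /c; case: eqVneq => [<-//|npp].
rewrite -pp (residual_orthogonal hM (Mx _)) ?mul0r //.
by apply: contra npp => /eqP e; rewrite [p]surjective_pairing [p']surjective_pairing e pp.
Qed.

End Freeness.

(** * The Hankel determinant *)

(** A permutation [s] contributes only if [f (s i) < f i] wherever [s i] differs
from [i]; as [s] preserves the sum of [f], it moves nothing. With ranks instead of
an order on the indices, the words need not be enumerated by length. *)
Lemma det_unitriangular (F : comNzRingType) N (A : 'M[F]_N) (f : 'I_N -> nat) :
  (forall i, A i i = 1) -> (forall i j, i != j -> (f i <= f j)%N -> A i j = 0) ->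
  \det A = 1.
Proof.
move=> A1 A0; rewrite /determinant (bigD1 (1%g : 'S_N)) //= [X in _ + X]big1 => [|s s1].
  by rewrite addr0 odd_perm1 expr0 mul1r big1 // => i _; rewrite perm1.
suff [i /andP[si fi]] : exists i, (i != s i) && (f i <= f (s i))%N.
  by rewrite (bigD1 i) //= A0 // mul0r mulr0.
apply/existsP; apply: contraR s1 => /existsPn nex.
have lt i : i != s i -> (f (s i) < f i)%N.
  by move=> isi; have := nex i; rewrite isi /= -ltnNge.
have le i : (f (s i) <= f i)%N.
  by have [<-|/lt/ltnW] := eqVneq i (s i).
apply/eqP/permP => i; rewrite perm1; apply/eqP; apply: contraT => sii.
have : (\sum_j f (s j) < \sum_j f j)%N.
  rewrite (bigD1 i) //= [ltnRHS](bigD1 i) //= -addSn leq_add //.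
    by rewrite lt // eq_sym.
  by apply: leq_sum => j _; exact: le.
by rewrite [ltnRHS](reindex_inj (@perm_inj _ s)) /= ltnn.
Qed.

Section Triangular.
Variables (R : realType) (H : completeNormedModType R[i]).
Variable dot : {dot H for @Num.conj R[i]}.
Variables (M : set (H -> H)) (tau : (H -> H) -> R[i]).
Hypothesis hM : free_probability_space dot M tau.
Let hV : von_neumann_algebra dot M := fps_vna hM.
Local Notation adj := (adj dot).
Local Notation ip := (l2dot dot tau).
Variables (n : nat) (x : 'I_n -> H -> H).
Hypothesis Mx : forall k, M (x k).
Local Notation P k j := (power_residual dot tau (x k) j).

(** The operators of degree less than [m]: inductive rather than a sum over
bounded words, so that products are treated one monomial at a time. *)
Inductive word_span (m : nat) : (H -> H) -> Prop :=
| word_span0 : word_span m 0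
| word_spanD c (w : seq 'I_n) a : (size w < m)%N -> word_span m a ->
    word_span m (c *: op_prod w x + a).

Lemma word_span_lin m c a b : word_span m a -> word_span m b -> word_span m (c *: a + b).
Proof.
move=> ma mb; elim: ma => [|d w a' wm _ IH]; first by rewrite scaler0 add0r.
by rewrite scalerDr scalerA -addrA; exact: word_spanD.
Qed.

Lemma word_span_word m w : (size w < m)%N -> word_span m (op_prod w x).
Proof.
move=> wm; rewrite -[op_prod _ _]addr0 -[op_prod _ _]scale1r.
by apply: word_spanD => //; exact: word_span0.
Qed.

Lemma word_in_algebra (w : seq 'I_n) : M (op_prod w x).
Proof. by apply: (vna_op_prod hV) => i _. Qed.

Lemma word_span_le m m' a : (m <= m')%N -> word_span m a -> word_span m' a.
Proof.
move=> mm; elim=> [|c w b wm _ IH]; first exact: word_span0.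
by apply: word_spanD => //; exact: leq_trans mm.
Qed.

Lemma word_span_comp p q a b :
  word_span p a -> word_span q b -> word_span (p + q).-1 (a \o b).
Proof.
move=> pa qb; elim: pa => [|c w a' wp _ IH]; first exact: word_span0.
rewrite comp_linl; apply: word_span_lin => //.
elim: qb => [|d v b' vq _ IH'].
  have -> : op_prod w x \o 0 = 0 :> (H -> H); last exact: word_span0.
  have := comp_linr hV (-1) 0 0 (word_in_algebra w).
  by rewrite scaler0 addr0 scaleN1r addNr.
rewrite (comp_linr hV) //; last exact: word_in_algebra.
rewrite -op_prod_cat; apply: word_spanD => //.
by rewrite size_cat; lia.
Qed.

Lemma residual_word_span k j : word_span j (P k j - (iter j (x k) : H -> H)).
Proof.
have [[c cE] _] := l2projP hM (Mx k) j.
rewrite /power_residual cE addrAC subrr add0r -scaleN1r -[_ *: _]addr0.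
apply: word_span_lin; last exact: word_span0.
elim/big_rec: _ => [|i a _ ja]; first exact: word_span0.
by rewrite -op_prod_nseq; apply: word_spanD; rewrite // size_nseq.
Qed.

(** Each factor [x_k^j] and its residual differ by lower powers of [x_k]; when the
product is expanded, only the full word keeps its length. *)
Lemma run_op_word_span r :
  word_span (size (of_runs r)) (run_op dot tau x r - op_prod (of_runs r) x).
Proof.
elim: r => [|[k j] r IH].
  rewrite /run_op /op_prod !big_nil subrr; exact: word_span0.
rewrite /run_op op_prod_cons -/(run_op _ _ _ _) /of_runs /= -/(of_runs r).
rewrite op_prod_cat op_prod_nseq size_cat size_nseq.
set X := op_prod (of_runs r) x in IH *; set Q := run_op _ _ _ _ in IH *.
have MP : M (P k j) by exact: (residual_in_algebra hM Mx).
have -> : (P k j \o Q) - (iter j (x k) \o X) =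
    1 *: ((P k j - (iter j (x k) : H -> H)) \o X) + (P k j \o (Q - X)).
  have -> : Q - X = (-1) *: X + Q by rewrite scaleN1r addrC.
  have -> : (P k j - (iter j (x k) : H -> H)) \o X = (P k j \o X) - (iter j (x k) \o X) by [].
  by rewrite (comp_linr hV) // scale1r scaleN1r addrACA subrr add0r addrC.
have h1 := residual_word_span k j.
apply: word_span_lin.
  have := word_span_comp h1 (word_span_word (ltnSn (size (of_runs r)))).
  by rewrite addnS.
have h2 : word_span j.+1 (P k j).
  rewrite -[P k j](subrK (iter j (x k) : H -> H)) -[X in word_span _ (X + _)]scale1r.
  apply: word_span_lin; first exact: word_span_le h1.
  by rewrite -op_prod_nseq; apply: word_span_word; rewrite size_nseq.
exact: (word_span_comp h2 IH).
Qed.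

Lemma word_span_coef m q a : (m <= q.+1)%N -> word_span m a ->
  exists c : q.-bseq 'I_n -> R[i], (forall w : q.-bseq 'I_n, (m <= size w)%N -> c w = 0) /\
    a = \sum_w c w *: op_prod w x.
Proof.
move=> mq; elim=> [|d w b wm _ [c [c0 ->]]].
  by exists (fun=> 0); split=> //; rewrite big1 // => w _; rewrite scale0r.
have wq : (size w <= q)%N by rewrite -ltnS (leq_trans wm).
exists (fun v => (if v == Bseq wq then d else 0) + c v); split=> [v mv|].
  rewrite c0 // addr0; case: eqP => // vw.
  by move: mv; rewrite vw leqNgt wm.
under [RHS]eq_bigr do rewrite scalerDl.
rewrite big_split /=; congr (_ + _).
rewrite (bigD1 (Bseq wq)) //= eqxx big1 ?addr0 // => v /negbTE ->.
by rewrite scale0r.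
Qed.

Lemma gram_det (N : nat) (v y : 'I_N -> H -> H) (A : 'M[R[i]]_N) :
  (forall i, M (v i)) -> (forall i, y i = \sum_j A i j *: v j) ->
  \det (\matrix_(i, j) ip (y j) (y i)) =
  (\det A)^* * \det A * \det (\matrix_(i, j) ip (v j) (v i)).
Proof.
move=> Mv yE.
have -> : \matrix_(i, j) ip (y j) (y i) =
    map_mx Num.conj A *m (\matrix_(i, j) ip (v j) (v i)) *m A^T.
  apply/matrixP => i j; rewrite !mxE !yE.
  have MA k l : M (A k l *: v l) by exact: (vna_scale hV).
  rewrite (l2dot_suml hM) //; last by apply: (vna_sum hV).
  apply: eq_bigr => l _; rewrite !mxE (l2dot_sumr hM) // mulr_suml.
  apply: eq_bigr => k _; rewrite !mxE (l2dotZl hM) // (l2dotZr hM) //.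
  by rewrite mulrC.
by rewrite !det_mulmx det_tr det_map_mx mulrAC.
Qed.

Hypothesis hfree : free_elements dot tau x.

(** Replacing the words by their products of residuals multiplies the Gram matrix
by unitriangular matrices on both sides and makes it diagonal. *)
Lemma hankel_det_run_prod q :
  hankel_det dot tau x q.+1 =
  run_prod (fun k j => l2norm dot tau (P k j) ^+ 2) q.
Proof.
rewrite /hankel_det /=.
set E := fun i : 'I_#|{: q.-bseq 'I_n}| => (enum_val i : q.-bseq 'I_n).
pose v i := op_prod (E i) x; pose y i := run_op dot tau x (runs (E i)).
(* the coordinates of the new family in the old one *)
have [A [A1 A0 yE]] : exists A : 'M[R[i]]_#|{: q.-bseq 'I_n}|,
    [/\ forall i, A i i = 1,
        forall i j, i != j -> (size (E i) <= size (E j))%N -> A i j = 0 &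
        forall i, y i = \sum_j A i j *: v j].
  have coef (w : q.-bseq 'I_n) : exists c : q.-bseq 'I_n -> R[i],
      (forall w' : q.-bseq 'I_n, (size w <= size w')%N -> c w' = 0) /\
      run_op dot tau x (runs w) - op_prod w x = \sum_w' c w' *: op_prod w' x.
    apply: word_span_coef; first by rewrite ltnW // ltnS size_bseq.
    by have := run_op_word_span (runs w); rewrite runsK.
  have [c cP] := choice coef.
  exists (\matrix_(i, j) ((i == j)%:R + c (E i) (E j))); split.
  - by move=> i; rewrite mxE eqxx (cP _).1 // addr0.
  - by move=> i j /negbTE ij sij; rewrite mxE ij (cP _).1 // addr0.
  move=> i; under eq_bigr do rewrite mxE scalerDl.
  rewrite big_split /= (bigD1 i) //= eqxx scale1r big1 ?addr0; last first.
    by move=> j; rewrite eq_sym => /negbTE ->; rewrite scale0r.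
  rewrite -(big_enum_val (fun w => c (E i) w *: op_prod w x)) /= -(cP (E i)).2.
  by rewrite addrC subrK.
have detA : \det A = 1 by exact: det_unitriangular A1 A0.
have := gram_det (fun i => word_in_algebra (E i)) yE.
rewrite detA conjC1 !mul1r => <-.
have -> : \matrix_(i, j) ip (y j) (y i) =
   diag_mx (\row_i \prod_(p <- runs (E i)) ip (P p.1 p.2) (P p.1 p.2)).
  apply/matrixP => i j; rewrite !mxE (run_op_l2dot hM) ?runs_alternate ?runs_gt0 //.
  rewrite (inj_eq (can_inj (@runsK _))) (inj_eq val_inj) (inj_eq enum_val_inj) eq_sym.
  by case: eqVneq => [->|]; rewrite ?mulr1n ?mulr0n.
rewrite det_diag; under eq_bigr do rewrite mxE.
rewrite -(big_enum_val (fun w : q.-bseq 'I_n =>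
  \prod_(p <- runs w) ip (P p.1 p.2) (P p.1 p.2))) /=.
rewrite -[RHS]/(complex.Re (run_prod _ q)%:C%C); congr complex.Re.
rewrite /run_prod -big_bseq rmorph_prod; apply: eq_bigr => w _.
rewrite rmorph_prod; apply: eq_bigr => p _.
by rewrite /= (l2norm_sqr hM) //; exact: (residual_in_algebra hM Mx).
Qed.

Lemma residual_norm_bound : exists2 K : R, 1 <= K &
  forall k j, l2norm dot tau (P k j) ^+ 2 <= K ^+ j.
Proof.
have bnd k : exists K : R[i], 0 <= K /\ forall u, `|x k u| <= K * `|u|.
  by have [K K0 xK] := bounded_operator_ge0 (vna_bounded hV (Mx k)); exists K.
have [K KP] := choice bnd.
pose K' := 1 + \sum_k complex.Re (K k ^+ 2).
have KC k : K k ^+ 2 = (complex.Re (K k ^+ 2))%:C%C.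
  have := exprn_ge0 2 (KP k).1; rewrite lecE /= => /andP[/eqP im0 _].
  by apply/eqP; rewrite eq_complex /= im0 !eqxx.
have K0 k : 0 <= complex.Re (K k ^+ 2).
  by have := exprn_ge0 2 (KP k).1; rewrite lecE /= => /andP[].
exists K'; first by rewrite lerDl sumr_ge0.
move=> k j; apply: (@le_trans _ _ (complex.Re (K k ^+ 2) ^+ j)).
  have MP : M (P k j) by exact: (residual_in_algebra hM Mx).
  rewrite -lecR [leRHS]rmorphXn (l2norm_sqr hM MP).
  rewrite [X in _ <= X ^+ _](_ : _ = K k ^+ 2); last by rewrite KC.
  apply: le_trans (residual_l2dot_le hM (Mx k) j) _.
  exact: (iter_l2dot_le hM (Mx k) (KP k).1 (KP k).2).
rewrite lerXn2r ?nnegrE // /K'; first by rewrite addr_ge0 ?sumr_ge0.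
by rewrite (bigD1 k) //= addrCA lerDl addr_ge0 // sumr_ge0.
Qed.

End Triangular.

Theorem theorem1 (R : realType) (H : completeNormedModType R[i])
    (dot : {dot H for @Num.conj R[i]})
    (M : set (H -> H)) (tau : (H -> H) -> R[i])
    (n : nat) (x : 'I_n -> H -> H)
    (hM : free_probability_space dot M tau)
    (hn : (2 <= n)%N)
    (hx : forall k, M (x k))
    (hfree : free_elements dot tau x) :
  ((lne (hankel_det dot tau x q.+1)%:E * ((q%:R * n%:R ^+ q)^-1)%:E)%E
     @[q --> \oo]) -->
  (((n%:R - 1) / n%:R)%:E * \sum_(k < n) entropy_number dot tau n (x k))%E.
Proof.
have [K K1 hK] := residual_norm_bound hM hx.
pose h k j := l2norm dot tau (power_residual dot tau (x k) j) ^+ 2.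
have h0 k : h k 0%N = 1.
  rewrite /h (residual0 hM) //; apply: complexI.
  by rewrite (l2norm_sqr hM) ?/l2dot ?adj_id ?(fps_unit hM) //; exact: (vna_id (fps_vna hM)).
have := @run_prod_cvg R 'I_n h K (fun k j => sqr_ge0 _) h0 K1 hK.
rewrite card_ord => /(_ hn).
under eq_fun do rewrite -(hankel_det_run_prod hM hx hfree).
exact.
Qed.
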